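(* Let $d\ge 1$, $n\ge1$ be integers and $\alpha\in(0,1)$. For a pure state $\rho=|\psi\rangle\langle\psi|$ on $\mathbb C^d$ with $|\psi\rangle=\sum_{k=1}^d\gamma_k|k\rangle$ ($(|k\rangle)_{k=1}^d$ a fixed orthonormal basis) let $p=[|\gamma_1|^2,\dots,|\gamma_d|^2]^\top$ be its probability vector. Then there exist a locally-$\alpha$-gentle measurement $M_{\delta(\alpha)}$ on $n$ copies of $\rho$ and a subsequent estimator $\hat p_n$ of $p$ such that $$\sup_{\rho\in\mathcal S_{pure}(\mathbb C^d)}\mathbb E_\rho\big[\|\hat p_n-p\|_2^2\big]\le 4\,\frac{d}{n\alpha^2}.$$
   Context: $\mathcal S(\mathbb C^d)$ is the set of density matrices on $\mathbb C^d$, $\mathcal S_{pure}(\mathbb C^d)$ the rank-one ones, $|\psi\rangle\langle\psi|$ with $\|\psi\|=1$. A measurement on $\mathbb C^d$ is a countable family $M=(M_\omega)_{\omega\in\Omega}$ of matrices in $\mathbb C^{d\times d}$ with $\sum_\omega M_\omega^*M_\omega=\mathbb 1$; put $E_\omega=M_\omega^*M_\omega$. Measuring $\rho$ yields a random outcome $R^M$ with $\mathbb P_\rho(R^M=\omega)=\operatorname{Tr}[\rho E_\omega]$ and, if this is positive, the post-measurement state $\rho_{M\to\omega}=M_\omega\rho M_\omega^*/\operatorname{Tr}[\rho E_\omega]$. With $\|A\|_{Tr}=\frac12\operatorname{Tr}|A|$, $M$ is $\alpha$-gentle on $\mathcal S(\mathbb C^d)$ if $\|\rho-\rho_{M\to\omega}\|_{Tr}\le\alpha$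 for all $\rho\in\mathcal S(\mathbb C^d)$ and all outcomes $\omega$ (of positive probability). A locally-$\alpha$-gentle measurement on $n$ copies is a product measurement $M_1\otimes\dots\otimes M_n$, applied to $\rho^{\otimes n}$, in which each $M_i$ is $\alpha$-gentle on $\mathcal S(\mathbb C^d)$. An estimator $\hat p_n$ is an $\mathbb R^d$-valued function of the outcome; the measurement and the estimator do not depend on $\rho$. *)

(* Defs.v *)
From HB Require Import structures.
From mathcomp Require Import all_boot all_order all_algebra finmap.
From mathcomp Require Import sesquilinear spectral.
From mathcomp Require Import all_classical all_reals all_analysis.
From mathcomp Require summability.
From mathcomp Require Export complex.

Set Implicit Arguments.
Unset Strict Implicit.
Unset Printing Implicit Defensive.

Import Order.TTheory GRing.Theory Num.Theory.
Import numFieldNormedType.Exports.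

Local Open Scope classical_set_scope.
Local Open Scope ring_scope.
Local Open Scope sesquilinear_scope.
Local Open Scope complex_scope.

Section Matrices.
Variable C : numClosedFieldType.

Definition psdmx (d : nat) (A : 'M[C]_d) : Prop :=
  A \is hermsymmx /\ forall v : 'cV[C]_d, 0 <= (v^t* *m A *m v) 0 0.

Definition density (d : nat) (rho : 'M[C]_d) : Prop :=
  psdmx rho /\ \tr rho = 1.

Definition ketbra (d : nat) (psi : 'cV[C]_d) : 'M[C]_d := psi *m psi^t*.

Definition pure_state (d : nat) (rho : 'M[C]_d) : Prop :=
  exists2 psi : 'cV[C]_d, psi^t* *m psi = 1%:M & rho = ketbra psi.

(* |A| = sqrt(A^* A), by functional calculus: the square root is applied to
   the eigenvalues of the normal matrix A^* A = U^-1 diag(D) U. *)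
Definition mxabs (d : nat) (A : 'M[C]_d) : 'M[C]_d :=
  let H := A^t* *m A in
  invmx (spectralmx H) *m diag_mx (map_mx sqrtC (spectral_diag H))
    *m spectralmx H.

Lemma normalmx_gram (d : nat) (A : 'M[C]_d) : A^t* *m A \is normalmx.
Proof. by apply/normalmxP; rewrite trmx_mul map_mxM trmxCK. Qed.

(* Together with mxabs_psd, this characterizes |A|. *)
Lemma mxabs_sqr (d : nat) (A : 'M[C]_d) : mxabs A *m mxabs A = A^t* *m A.
Proof.
rewrite [RHS](orthomx_spectralP (normalmx_gram A)) /mxabs.
set U := spectralmx _; set D := spectral_diag _.
have Uu : U \in unitmx by apply: spectral_unit.
rewrite !mulmxA -[_ *m U *m invmx U]mulmxA mulmxV // mulmx1.
congr (_ *m U); rewrite -mulmxA mulmx_diag; congr (_ *m diag_mx _).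
by apply/rowP => i; rewrite !mxE -expr2 sqrtCK.
Qed.

Lemma mxabs_psd (d : nat) (A : 'M[C]_d) : psdmx (mxabs A).
Proof.
rewrite /mxabs; set H := A^t* *m A.
set U := spectralmx H; set D := spectral_diag H.
have Uun : U \is unitarymx by apply: spectral_unitarymx.
have UU : U *m U^t* = 1%:M by apply/unitarymxP.
have HE : H = U^t* *m diag_mx D *m U.
  by rewrite -invmx_unitary //; apply/orthomx_spectralP/normalmx_gram.
have DE : diag_mx D = (A *m U^t*)^t* *m (A *m U^t*).
  rewrite trmx_mul map_mxM trmxCK -mulmxA [_ *m (A *m _)]mulmxA -/H HE.
  by rewrite !mulmxA UU mul1mx -mulmxA UU mulmx1.
have D_ge0 i : 0 <= D 0 i.
  have /matrixP/(_ i i) := DE; rewrite [LHS]mxE eqxx mulr1n => ->.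
  rewrite mxE sumr_ge0 // => k _.
  by rewrite !mxE mulrC mul_conjC_ge0.
have S_ge0 i : 0 <= map_mx sqrtC D 0 i by rewrite mxE sqrtC_ge0.
rewrite invmx_unitary //; split.
  apply/is_hermitianmxP; rewrite expr0 scale1r !trmx_mul !map_mxM trmxCK.
  rewrite mulmxA tr_diag_mx map_diag_mx; congr (_ *m diag_mx _ *m _).
  by apply/rowP => i; have := ger0_real (S_ge0 i) => /CrealP <-; rewrite !mxE.
move=> v.
have -> : v^t* *m (U^t* *m diag_mx (map_mx sqrtC D) *m U) *m v =
          (U *m v)^t* *m (diag_mx (map_mx sqrtC D) *m (U *m v)).
  by rewrite trmx_mul map_mxM !mulmxA.
rewrite mxE sumr_ge0 // => k _; rewrite mul_diag_mx [X in _ * X]mxE.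
by rewrite mulrCA mulr_ge0 // !mxE mulrC mul_conjC_ge0.
Qed.

(* Half the usual Schatten 1-norm. *)
Definition trace_norm (d : nat) (A : 'M[C]_d) : C := 2^-1 * \tr (mxabs A).

(* A_1 \otimes ... \otimes A_n on (C^d)^{\otimes n}, whose canonical basis is
   indexed by the maps 'I_n -> 'I_d (enumerated by enum_val). *)
Definition tensor (n d : nat) (A : 'I_n -> 'M[C]_d) :
    'M[C]_#|{ffun 'I_n -> 'I_d}| :=
  \matrix_(s, t) \prod_(i < n)
    A i ((enum_val s : {ffun 'I_n -> 'I_d}) i)
        ((enum_val t : {ffun 'I_n -> 'I_d}) i).

Definition orthonormal_kets (d : nat) (ket : 'I_d -> 'cV[C]_d) : Prop :=
  forall j k, (ket j)^t* *m ket k = (j == k)%:R%:M.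

End Matrices.

(* Unconditional convergence: limit along the net of finite subsets of T, for
   the entrywise topology on matrices. *)
Definition mx_has_sum (K : numFieldType) (d : nat) (T : choiceType)
    (f : T -> 'M[K]_d) (S : 'M[K]_d) : Prop :=
  summability.partial_sum f @ summability.totally --> S.

Record measurement (R : realType) (d : nat) := Measurement {
  outcome : countType;
  kraus :> outcome -> 'M[R[i]]_d;
  kraus_complete : mx_has_sum (fun w => (kraus w)^t* *m kraus w) 1%:M }.

Section Measurements.
Variable R : realType.

(* The trace is a nonnegative real when rho is positive semidefinite. *)
Definition outcome_prob (d : nat) (rho K : 'M[R[i]]_d) : R :=
  complex.Re (\tr (rho *m (K^t* *m K))).

Definition post_state (d : nat) (rho K : 'M[R[i]]_d) : 'M[R[i]]_d :=
  ((outcome_prob rho K)%:C)^-1 *: (K *m rho *m K^t*).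

Definition gentle (alpha : R) (d : nat) (M : measurement R d) : Prop :=
  forall (rho : 'M[R[i]]_d) (w : outcome M),
    density rho -> 0 < outcome_prob rho (M w) ->
    trace_norm (rho - post_state rho (M w)) <= alpha%:C.

Definition locally_gentle (alpha : R) (n d : nat)
    (M : 'I_n -> measurement R d) : Prop :=
  forall i, gentle alpha (M i).

Definition joint_outcome (n d : nat) (M : 'I_n -> measurement R d) : countType :=
  {dffun forall i, outcome (M i)}.

Definition product_kraus (n d : nat) (M : 'I_n -> measurement R d)
    (w : joint_outcome M) : 'M[R[i]]_#|{ffun 'I_n -> 'I_d}| :=
  tensor (fun i => M i (w i)).

(* E_rho ||phat - p||_2^2; the sum has nonnegative terms, hence lives in the
   extended reals. The library norm on vectors is the sup norm, so the Euclidean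
   one is spelled out. *)
Definition mean_sq_error (n d : nat) (M : 'I_n -> measurement R d)
    (phat : joint_outcome M -> 'cV[R]_d) (rho : 'M[R[i]]_d) (p : 'cV[R]_d) :
    \bar R :=
  \esum_(w in [set: joint_outcome M])
    (outcome_prob (tensor (fun _ : 'I_n => rho)) (product_kraus w)
     * \sum_k (phat w k 0 - p k 0) ^+ 2)%:E.

(* rho fixes the amplitudes gamma up to a common phase, so p is unique. *)
Definition prob_vector_of (d : nat) (ket : 'I_d -> 'cV[R[i]]_d)
    (rho : 'M[R[i]]_d) (p : 'cV[R]_d) : Prop :=
  exists2 gamma : 'I_d -> R[i],
    rho = ketbra (\sum_k gamma k *: ket k)
    & forall k, (p k 0)%:C = `|gamma k| ^+ 2.

End Measurements.

(* Main.v *)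
Require Import Defs.
From mathcomp Require Import all_boot all_order all_algebra finmap.
From mathcomp Require Import sesquilinear spectral ring lra.
From mathcomp Require Import all_classical all_reals all_analysis.

(** The measurement hides the populations p_k = <k|rho|k> behind random signs.
    Each copy yields a sign vector w in {-1, 1}^d with probability
    2^-d (1 + b sum_k p_k w_k), where b = alpha / 2; the Kraus operators are
    the square roots, diagonal in the basis |k>, of the effects
    2^-d (1 + b w_k). Two features of this choice give the theorem.

    The effects are nearly scalar: the ratio of any two eigenvalues is at most
    (1 + b) / (1 - b), so the normalized Kraus operator S that sends rho to its
    post-measurement state S rho S^* is within 2 b = alpha of the identity
    ([sqrt_ratio_close]). For an arbitrary state, the disturbance
    rho - S rho S^* = (1 - S) rho + S rho (1 - S)^* has trace norm at most
    the size of 1 - S in the form (P, Q) |-> tr (P rho Q^* ), by Cauchy-Schwarz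
    for this form once the trace of the absolute value is written as tr (W A)
    with W a contraction ([trace_norm_disturbance]). Hence every such
    measurement is alpha-gentle.

    The signs are informative in every coordinate at once: w_k has mean b p_k
    and square 1. The empirical mean of w_k over the n copies, divided by b, is
    therefore an unbiased estimator of p_k with variance at most 1 / (n b^2),
    and the d coordinates contribute d / (n b^2) = 4 d / (n alpha^2)
    ([risk_of_mean_sign]). The outcomes on the n copies are independent
    because the trace of a tensor product is the product of the traces
    ([outcome_prob_tensor]). *)

Set Implicit Arguments.
Unset Strict Implicit.
Unset Printing Implicit Defensive.

Import Order.TTheory GRing.Theory Num.Theory.
Import numFieldNormedType.Exports.
Local Open Scope classical_set_scope.
Local Open Scope ring_scope.
Local Open Scope sesquilinear_scope.

(** * Trace norm of the disturbance of a state *)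

Section MatrixForms.
Variable C : numClosedFieldType.

Lemma adjmxM m n p (A : 'M[C]_(m, n)) (B : 'M[C]_(n, p)) :
  (A *m B)^t* = B^t* *m A^t*.
Proof. by rewrite trmx_mul map_mxM. Qed.

Lemma adjmxB m n (A B : 'M[C]_(m, n)) : (A - B)^t* = A^t* - B^t*.
Proof. by apply/matrixP => i j; rewrite !mxE rmorphB. Qed.

Lemma adjmxZ m n (c : C) (A : 'M[C]_(m, n)) : (c *: A)^t* = c^* *: A^t*.
Proof. by apply/matrixP => i j; rewrite !mxE rmorphM. Qed.

Lemma adjmx_sum (I : finType) m n (F : I -> 'M[C]_(m, n)) :
  (\sum_i F i)^t* = \sum_i (F i)^t*.
Proof.
apply/matrixP => i j; rewrite !mxE !summxE rmorph_sum.
by apply: eq_bigr => k _; rewrite !mxE.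
Qed.

Lemma adjmx1 n : (1%:M : 'M[C]_n)^t* = 1%:M.
Proof. by rewrite trmx1 map_mx1. Qed.

Lemma mxtrace_adj n (A : 'M[C]_n) : \tr (A^t*) = (\tr A)^*.
Proof. by rewrite /mxtrace rmorph_sum; apply: eq_bigr => i _; rewrite !mxE. Qed.

Lemma psdmx_adj d (rho : 'M[C]_d) : psdmx rho -> rho^t* = rho.
Proof. by case=> /is_hermitianmxP; rewrite expr0 scale1r => <-. Qed.

Lemma psdmx_trace_ge0 m d (rho : 'M[C]_d) (Z : 'M[C]_(m, d)) :
  psdmx rho -> 0 <= \tr (Z *m rho *m Z^t*).
Proof.
case=> _ rho_ge0; apply: sumr_ge0 => i _.
have := rho_ge0 ((row i Z)^t*); rewrite trmxCK.
suff -> : (row i Z *m rho *m (row i Z)^t*) 0 0 = (Z *m rho *m Z^t*) i i by [].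
rewrite -row_mul !mxE; apply: eq_bigr => j _.
by rewrite !mxE.
Qed.

Lemma psdmx_conj m d (rho : 'M[C]_d) (Z : 'M[C]_(m, d)) :
  psdmx rho -> psdmx (Z *m rho *m Z^t*).
Proof.
move=> rho_psd; split.
  apply/is_hermitianmxP; rewrite expr0 scale1r !adjmxM trmxCK.
  by rewrite psdmx_adj // mulmxA.
move=> v; case: rho_psd => _ /(_ (Z^t* *m v)).
by rewrite adjmxM trmxCK !mulmxA.
Qed.

(** Cauchy-Schwarz for the positive form (P, Q) |-> tr (P rho Q^* ), in the
    additive shape obtained by expanding the value of the form at P - a Q. *)
Lemma psdmx_trace_young m d (rho : 'M[C]_d) (P Q : 'M[C]_(m, d)) (a : C) :
  psdmx rho -> 0 < a ->
  \tr (P *m rho *m Q^t*) + \tr (Q *m rho *m P^t*) <=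
    a^-1 * \tr (P *m rho *m P^t*) + a * \tr (Q *m rho *m Q^t*).
Proof.
move=> rho_psd a_gt0; have a_ne0 : a != 0 by rewrite gt_eqF.
have aC : a^* = a by apply/CrealP/gtr0_real.
have := psdmx_trace_ge0 (P - a *: Q) rho_psd.
rewrite adjmxB adjmxZ aC !mulmxBl !mulmxBr -!scalemxAl -!scalemxAr !linearB /=.
rewrite !linearZ /=.
move=> /(mulr_ge0 (ltW (etrans (invr_gt0 a) a_gt0))) sq_ge0.
rewrite -subr_ge0; apply: le_trans sq_ge0 _.
rewrite !linearZ /= /GRing.scale /= le_eqVlt; apply/orP; left; apply/eqP.
by field.
Qed.

(** The hypothesis says W W^* <= 1, the defect being exhibited as a square so
    that its contribution to the trace is visibly nonnegative. *)
Lemma contraction_trace_le d (rho W Z : 'M[C]_d) :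
  psdmx rho -> W *m W^t* + Z^t* *m Z = 1%:M ->
  \tr (W^t* *m rho *m W) <= \tr rho.
Proof.
move=> rho_psd WZ1; rewrite -[X in _ <= \tr X]mulmx1 -WZ1 mulmxDr linearD /=.
rewrite -mulmxA mxtrace_mulC -mulmxA lerDl.
by rewrite mulmxA mxtrace_mulC mulmxA psdmx_trace_ge0.
Qed.

(** Half of the polar decomposition: it linearizes A |-> tr |A|. With
    A^* A = U^* diag (s^2) U, take W = U^* diag (1/s) U A^*; since 1/0 = 0,
    W W^* is the projection onto the eigenspaces with s <> 0, and Z^* Z is the
    complementary one. *)
Lemma mxabs_polar d (A : 'M[C]_d) :
  exists W Z : 'M[C]_d, mxabs A = W *m A /\ W *m W^t* + Z^t* *m Z = 1%:M.
Proof.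
set H := A^t* *m A.
set U := spectralmx H; set D := spectral_diag H.
have Uun : U \is unitarymx by apply: spectral_unitarymx.
have UU : U *m U^t* = 1%:M by apply/unitarymxP.
have UU' : U^t* *m U = 1%:M by apply: mulmx1C.
have HE : H = U^t* *m diag_mx D *m U.
  by rewrite -invmx_unitary //; apply/orthomx_spectralP/normalmx_gram.
have DE : diag_mx D = (A *m U^t*)^t* *m (A *m U^t*).
  rewrite adjmxM trmxCK -mulmxA [_ *m (A *m _)]mulmxA -/H HE.
  by rewrite !mulmxA UU mul1mx -mulmxA UU mulmx1.
have D_ge0 i : 0 <= D 0 i.
  have /matrixP/(_ i i) := DE; rewrite [LHS]mxE eqxx mulr1n => ->.
  rewrite mxE sumr_ge0 // => k _.
  by rewrite !mxE mulrC mul_conjC_ge0.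
have [s [sdef s_ge0 sE]] : exists s : 'rV[C]_d, [/\ map_mx sqrtC D = s,
    forall i, 0 <= s 0 i & forall i, D 0 i = s 0 i * s 0 i].
  exists (map_mx sqrtC D); split=> // i; first by rewrite mxE sqrtC_ge0.
  by rewrite !mxE -expr2 sqrtCK.
pose t : 'rV[C]_d := \row_i (s 0 i)^-1.
pose z : 'rV[C]_d := \row_i (s 0 i == 0)%:R.
have diagC (x : 'rV[C]_d) : (forall i, 0 <= x 0 i) ->
    (diag_mx x)^t* = diag_mx x.
  move=> x_ge0; rewrite tr_diag_mx map_diag_mx; congr diag_mx.
  by apply/rowP => i; rewrite !mxE; apply/CrealP/ger0_real.
have tC : (diag_mx t)^t* = diag_mx t.
  by apply: diagC => i; rewrite mxE invr_ge0.
have zC : (diag_mx z)^t* = diag_mx z.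
  by apply: diagC => i; rewrite mxE ler0n.
exists (U^t* *m diag_mx t *m U *m A^t*), (diag_mx z *m U); split.
  rewrite -mulmxA -/H HE /mxabs -/H -/U -/D sdef invmx_unitary //.
  rewrite !mulmxA -[_ *m U *m U^t*]mulmxA UU mulmx1.
  rewrite -[_ *m diag_mx t *m diag_mx D]mulmxA mulmx_diag.
  congr (_ *m diag_mx _ *m _); apply/rowP => i; rewrite [RHS]mxE sE mxE.
  have [->|s_ne0] := eqVneq (s 0 i) 0; first by rewrite !mulr0.
  by rewrite mulKf.
rewrite !adjmxM !trmxCK tC zC.
have -> : U^t* *m diag_mx t *m U *m A^t* *m (A *m (U^t* *m (diag_mx t *m U))) =
  U^t* *m (diag_mx t *m diag_mx D *m diag_mx t) *m U.
  rewrite -[_ *m A^t* *m _]mulmxA [A^t* *m _]mulmxA -/H HE !mulmxA.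
  rewrite -[_ *m U *m U^t*]mulmxA UU mulmx1.
  by rewrite -[_ *m U *m U^t*]mulmxA UU mulmx1.
rewrite !mulmxA -[_ *m diag_mx z *m diag_mx z]mulmxA -mulmxDl -!mulmxA -mulmxDr.
rewrite !mulmx_diag.
rewrite -linearD /= [X in diag_mx X](_ : _ = const_mx 1).
  by rewrite diag_const_mx mulmx1 UU'.
apply/rowP => i; rewrite !mxE sE.
have [->|s_ne0] := eqVneq (s 0 i) 0; first by rewrite !mul0r mulr0 add0r mulr1.
by rewrite mulr0 addr0 mulfK // mulVf.
Qed.

(** A state moves no further in trace distance than the root mean square of
    1 - S in that state. With T = 1 - S, the difference A = rho - S rho S^*
    equals T rho + S rho T^*; for the contraction W of [mxabs_polar], tr (W A)
    is then a sum of two values of the form (P, Q) |-> tr (P rho Q^* ), each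
    pairing an element of norm at most a with one of norm at most 1. *)
Lemma trace_norm_disturbance d (rho S : 'M[C]_d) (a : C) :
  density rho -> 0 < a -> \tr (S *m rho *m S^t*) = 1 ->
  \tr ((1%:M - S) *m rho *m (1%:M - S)^t*) <= a ^+ 2 ->
  trace_norm (rho - S *m rho *m S^t*) <= a.
Proof.
move=> [rho_psd rho1] a_gt0 S1 leSa.
set A := rho - _; set T := 1%:M - S.
have [W [Z [absE WZ1]]] := mxabs_polar A.
have AE : A = T *m rho + S *m rho *m T^t*.
  by rewrite /T adjmxB adjmx1 mulmxBl mul1mx mulmxBr mulmx1 addrA subrK.
have traceWA : \tr (mxabs A) = \tr (T *m rho *m W)
                             + \tr (S *m rho *m (T^t* *m W)).
  by rewrite absE mxtrace_mulC AE mulmxDl linearD /= !mulmxA.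
have trC : \tr (mxabs A) = \tr (W^t* *m rho *m T^t*)
                             + \tr (W^t* *m T *m rho *m S^t*).
  rewrite -[in LHS](psdmx_adj (mxabs_psd A)) mxtrace_adj traceWA rmorphD /=.
  by rewrite -!mxtrace_adj !adjmxM trmxCK (psdmx_adj rho_psd) !mulmxA.
have ineq1 := psdmx_trace_young T (W^t*) rho_psd a_gt0.
have ineq2 := psdmx_trace_young (W^t* *m T) S rho_psd a_gt0.
rewrite trmxCK in ineq1.
rewrite adjmxM trmxCK in ineq2.
have WT : \tr (W^t* *m T *m rho *m (T^t* *m W)) <= a ^+ 2.
  apply: le_trans leSa.
  rewrite mulmxA -[_ *m T *m rho]mulmxA -[_ *m (T *m rho) *m _]mulmxA.
  by apply: contraction_trace_le WZ1; apply: psdmx_conj.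
have Wr : \tr (W^t* *m rho *m W) <= 1.
  by rewrite -rho1; apply: contraction_trace_le WZ1.
have scale x : x <= a ^+ 2 -> a^-1 * x <= a.
  by move=> xa; rewrite ler_pdivrMl // -expr2.
(* [psdmx_trace_young] bounds twice the real part of a value of the form;
   the trace of |A| is real, hence half its sum with its conjugate. *)
have bnd : \tr (mxabs A) + \tr (mxabs A) <= a *+ 4.
  rewrite {1}traceWA trC addrACA [X in _ + X <= _]addrC.
  apply: le_trans (lerD ineq1 ineq2) _.
  rewrite [in leRHS](_ : 4 = 1 + 1 + (1 + 1))%N // !mulrnDr !mulr1n.
  apply: lerD; apply: lerD; rewrite ?scale ?ler_piMr // ?(ltW a_gt0) //.
  by rewrite S1.
rewrite /trace_norm ler_pdivrMl ?ltr0n //.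
rewrite -(ler_pM2l (_ : 0 < 2%:R :> C)) ?ltr0n // mulr_natl mulr2n.
by rewrite (le_trans bnd) // mulrA -natrM mulr_natl.
Qed.

End MatrixForms.

Local Open Scope complex_scope.

(** * Operators diagonal in an orthonormal basis *)

Section DiagonalMeasurements.
Variables (R : realType) (d : nat) (ket : 'I_d -> 'cV[R[i]]_d).
Hypothesis hket : orthonormal_kets ket.
Implicit Types (rho : 'M[R[i]]_d) (x y : 'I_d -> R).

Definition kdiag x : 'M[R[i]]_d := \sum_k (x k)%:C *: ketbra (ket k).

Definition population rho k : R := complex.Re (\tr (rho *m ketbra (ket k))).

Lemma conjC_real (a : R) : ((a%:C)^* = a%:C)%R.
Proof. by apply/CrealP/complex_realP; exists a. Qed.

Lemma ketbra_mul j k :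
  ketbra (ket j) *m ketbra (ket k) = (j == k)%:R *: ketbra (ket k).
Proof.
rewrite /ketbra mulmxA -[_ *m _ *m ket k]mulmxA hket mul_mx_scalar -scalemxAl.
by have [->|] := eqVneq j k; rewrite ?scale0r.
Qed.

(** An orthonormal family of d vectors in dimension d is complete: a left
    inverse of a square matrix is a right inverse. *)
Lemma sum_ketbra : \sum_k ketbra (ket k) = 1%:M.
Proof.
pose V : 'M[R[i]]_d := \matrix_(i, k) ket k i 0.
suff VV : V *m V^t* = 1%:M.
  rewrite -VV; apply/matrixP => i j; rewrite !mxE summxE.
  by apply: eq_bigr => k _; rewrite !mxE big_ord1 !mxE.
apply: mulmx1C; apply/matrixP => j k.
have /matrixP/(_ 0 0) := hket j k; rewrite !mxE eqxx mulr1n => <-.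
by apply: eq_bigr => i _; rewrite !mxE.
Qed.

Lemma kdiagM x y : kdiag x *m kdiag y = kdiag (fun k => x k * y k).
Proof.
rewrite /kdiag mulmx_suml; apply: eq_bigr => j _.
rewrite mulmx_sumr (bigD1 j) //= big1 ?addr0 => [|k /negPf jk].
  by rewrite -scalemxAl -scalemxAr ketbra_mul eqxx !scalerA mulr1 rmorphM.
by rewrite -scalemxAl -scalemxAr ketbra_mul eq_sym jk mulr0n scale0r !scaler0.
Qed.

Lemma kdiag_adj x : (kdiag x)^t* = kdiag x.
Proof.
rewrite /kdiag adjmx_sum; apply: eq_bigr => k _.
by rewrite adjmxZ conjC_real /ketbra adjmxM trmxCK.
Qed.

Lemma kdiag1 : kdiag (fun=> 1) = 1%:M.
Proof. by rewrite -sum_ketbra; apply: eq_bigr => k _; rewrite scale1r. Qed.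

Lemma kdiagB x y : kdiag x - kdiag y = kdiag (fun k => x k - y k).
Proof.
by rewrite -sumrB; apply: eq_bigr => k _; rewrite -scalerBl -rmorphB.
Qed.

Lemma kdiagZ (a : R) x : a%:C *: kdiag x = kdiag (fun k => a * x k).
Proof.
by rewrite scaler_sumr; apply: eq_bigr => k _; rewrite scalerA rmorphM.
Qed.

Section State.
Variable rho : 'M[R[i]]_d.
Hypothesis rho_dens : density rho.

Lemma trace_ketbra_ge0 k : 0 <= \tr (rho *m ketbra (ket k)).
Proof.
case: rho_dens => rho_psd _; have := psdmx_trace_ge0 ((ket k)^t*) rho_psd.
by rewrite trmxCK -mulmxA mxtrace_mulC -mulmxA.
Qed.

Lemma populationE k : (population rho k)%:C = \tr (rho *m ketbra (ket k)).
Proof. by apply/RRe_real/ger0_real/trace_ketbra_ge0. Qed.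

Lemma population_ge0 k : 0 <= population rho k.
Proof. by rewrite -lecR populationE trace_ketbra_ge0. Qed.

Lemma trace_kdiag x :
  \tr (rho *m kdiag x) = (\sum_k x k * population rho k)%:C.
Proof.
rewrite mulmx_sumr !raddf_sum /=; apply: eq_bigr => k _.
by rewrite -scalemxAr mxtraceZ -populationE rmorphM.
Qed.

Lemma sum_population : \sum_k population rho k = 1.
Proof.
apply: complexI; case: rho_dens => _ rho1.
rewrite [RHS]rmorph1 -rho1 -[X in _ = \tr X]mulmx1 -kdiag1 trace_kdiag.
by under [in RHS]eq_bigr do rewrite mul1r.
Qed.

Lemma trace_kdiag_conj x :
  \tr (kdiag x *m rho *m (kdiag x)^t*)
  = (\sum_k x k ^+ 2 * population rho k)%:C.
Proof. by rewrite kdiag_adj -mulmxA mxtrace_mulC -mulmxA kdiagM trace_kdiag. Qed.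

Lemma outcome_prob_kdiag x :
  outcome_prob rho (kdiag x) = \sum_k x k ^+ 2 * population rho k.
Proof. by rewrite /outcome_prob kdiag_adj kdiagM trace_kdiag. Qed.

End State.

(** The rescaled operator x / sqrt t, with t the probability of the outcome,
    produces the normalized post-measurement state, so
    [trace_norm_disturbance] applies to it; the mean square of 1 - x / sqrt t
    is an average of the squares of its eigenvalues, weighted by the
    populations. *)
Lemma gentle_kdiag x rho (a : R) :
  density rho -> 0 < a -> 0 < outcome_prob rho (kdiag x) ->
  (forall k, `|1 - x k / Num.sqrt (outcome_prob rho (kdiag x))| <= a) ->
  trace_norm (rho - post_state rho (kdiag x)) <= a%:C.
Proof.
move=> rho_dens a_gt0; set t := outcome_prob _ _ => t_gt0 x_close.
pose y k := (Num.sqrt t)^-1 * x k.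
have tE : (Num.sqrt t)^-1 ^+ 2 = t^-1 by rewrite exprVn sqr_sqrtr // ltW.
have postE : post_state rho (kdiag x) = kdiag y *m rho *m (kdiag y)^t*.
  rewrite /post_state -/t -[kdiag y]kdiagZ adjmxZ conjC_real.
  rewrite -!scalemxAl -scalemxAr scalerA -rmorphM -expr2 tE.
  by rewrite fmorphV.
rewrite postE; apply: trace_norm_disturbance => //; first by rewrite ltcR.
  rewrite trace_kdiag_conj //; apply/eqP.
  under eq_bigr do rewrite exprMn tE -mulrA.
  by rewrite -mulr_sumr -outcome_prob_kdiag // -/t mulVf // gt_eqF.
rewrite -kdiag1 kdiagB trace_kdiag_conj // -rmorphXn lecR /=.
rewrite -[leRHS]mulr1 -[X in _ <= _ * X](sum_population rho_dens) mulr_sumr.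
apply: ler_sum => k _; apply: ler_wpM2r; first exact: population_ge0.
by rewrite -real_normK ?num_real // lerXn2r ?nnegrE // ?(ltW a_gt0) // /y mulrC.
Qed.

End DiagonalMeasurements.

Section States.
Variables (R : realType) (d : nat).

Lemma density_pure (rho : 'M[R[i]]_d) : pure_state rho -> density rho.
Proof.
case=> psi psi1 ->; split; last first.
  by rewrite /ketbra mxtrace_mulC psi1 mxtrace1.
split.
  by apply/is_hermitianmxP; rewrite expr0 scale1r /ketbra adjmxM trmxCK.
move=> v; rewrite /ketbra.
have -> : v^t* *m (psi *m psi^t*) *m v = (psi^t* *m v)^t* *m (psi^t* *m v).
  by rewrite adjmxM trmxCK !mulmxA.
by rewrite mxE sumr_ge0 // => k _; rewrite !mxE mulrC mul_conjC_ge0.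
Qed.

(** The overlap of |k> with the vector is gamma_k, and the common phase left
    free by rho cancels in its squared modulus. *)
Lemma population_prob_vector (ket : 'I_d -> 'cV[R[i]]_d)
    (rho : 'M[R[i]]_d) (p : 'cV[R]_d) k :
  orthonormal_kets ket -> prob_vector_of ket rho p ->
  p k 0 = population ket rho k.
Proof.
move=> hket [gamma rhoE pE]; rewrite /population.
suff -> : \tr (rho *m ketbra (ket k)) = `|gamma k| ^+ 2 by rewrite -pE.
have ampE : (\sum_j gamma j *: ket j)^t* *m ket k = ((gamma k)^*)%R%:M.
  rewrite adjmx_sum mulmx_suml (bigD1 k) //= big1 ?addr0 => [|j /negPf jk].
    by rewrite adjmxZ -scalemxAl hket eqxx scale_scalar_mx mulr1.
  by rewrite adjmxZ -scalemxAl hket jk scale_scalar_mx mulr0 raddf0.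
have ampC : (ket k)^t* *m (\sum_j gamma j *: ket j) = (gamma k)%:M.
  rewrite mulmx_sumr (bigD1 k) //= big1 ?addr0 => [|j].
    by rewrite -scalemxAr hket eqxx scale_scalar_mx mulr1.
  rewrite eq_sym => /negPf kj.
  by rewrite -scalemxAr hket kj scale_scalar_mx mulr0 raddf0.
rewrite rhoE /ketbra mulmxA -[_ *m _ *m ket k]mulmxA ampE mul_mx_scalar.
rewrite -scalemxAl mxtraceZ mxtrace_mulC ampC mxtrace_scalar mulr1n.
by rewrite mulrC -normCK.
Qed.

Lemma outcome_probE (rho K : 'M[R[i]]_d) : psdmx rho ->
  (outcome_prob rho K)%:C = \tr (rho *m (K^t* *m K)).
Proof.
move=> rho_psd; apply/RRe_real/ger0_real.
by have := psdmx_trace_ge0 K rho_psd; rewrite -mulmxA mxtrace_mulC -mulmxA.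
Qed.

End States.

(** * Tensor products and independent samples *)

Section Tensor.
Variable C : numClosedFieldType.

Lemma sum_enum_val (T : finType) (V : nmodType) (F : T -> V) :
  \sum_(s < #|T|) F (enum_val s) = \sum_t F t.
Proof. by rewrite -(big_enum_val F). Qed.

Lemma tensor_mulmx n d (A B : 'I_n -> 'M[C]_d) :
  tensor A *m tensor B = tensor (fun i => A i *m B i).
Proof.
apply/matrixP => s t; rewrite !mxE.
under [in RHS]eq_bigr do rewrite mxE.
rewrite bigA_distr_bigA /= -[RHS]sum_enum_val.
by apply: eq_bigr => u _; rewrite !mxE -big_split.
Qed.

Lemma tensor_adj n d (A : 'I_n -> 'M[C]_d) :
  (tensor A)^t* = tensor (fun i => (A i)^t*).
Proof.
apply/matrixP => s t; rewrite !mxE rmorph_prod.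
by apply: eq_bigr => i _; rewrite !mxE.
Qed.

Lemma mxtrace_tensor n d (A : 'I_n -> 'M[C]_d) :
  \tr (tensor A) = \prod_i \tr (A i).
Proof.
rewrite /mxtrace bigA_distr_bigA /= -[RHS]sum_enum_val.
by apply: eq_bigr => s _; rewrite !mxE.
Qed.

End Tensor.

Lemma outcome_prob_tensor (R : realType) n d (rho : 'M[R[i]]_d)
    (K : 'I_n -> 'M[R[i]]_d) :
  psdmx rho ->
  outcome_prob (tensor (fun _ : 'I_n => rho)) (tensor K) =
    \prod_i outcome_prob rho (K i).
Proof.
move=> rho_psd; rewrite {1}/outcome_prob tensor_adj !tensor_mulmx mxtrace_tensor.
under eq_bigr do rewrite -(outcome_probE _ rho_psd).
by rewrite -rmorph_prod.
Qed.

Section IndependentSamples.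
Variables (R : comNzRingType) (T : finType).

Lemma sum_prod_ffun n (F : 'I_n -> T -> R) :
  \sum_(w : {ffun 'I_n -> T}) \prod_i F i (w i) = \prod_i \sum_t F i t.
Proof. by rewrite bigA_distr_bigA. Qed.

(** The off-diagonal terms of the expanded square vanish because each of them
    factors through the mean of f. *)
Lemma second_moment_iid_sum n (q f : T -> R) :
  \sum_t q t = 1 -> \sum_t q t * f t = 0 ->
  \sum_(w : {ffun 'I_n -> T}) (\prod_i q (w i)) * (\sum_i f (w i)) ^+ 2 =
    (\sum_t q t * f t ^+ 2) *+ n.
Proof.
move=> q1 qf0.
have expand (w : {ffun 'I_n -> T}) :
    (\prod_i q (w i)) * (\sum_i f (w i)) ^+ 2 =
    \sum_i \sum_j (\prod_l q (w l)) * (f (w i) * f (w j)).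
  rewrite expr2 big_distrlr /= mulr_sumr.
  by apply: eq_bigr => i _; rewrite mulr_sumr.
under eq_bigr do rewrite expand.
rewrite exchange_big /=; under eq_bigr do rewrite exchange_big /=.
rewrite -[n in RHS]card_ord -sumr_const; apply: eq_bigr => i _.
have weighted (g : 'I_n -> T -> R) :
  \sum_(w : {ffun 'I_n -> T}) (\prod_l q (w l)) * \prod_l g l (w l) =
  \prod_l \sum_t q t * g l t.
  by rewrite -sum_prod_ffun; apply: eq_bigr => w _; rewrite -big_split.
(* Write a function of one coordinate as a product over all of them. *)
have pick (j : 'I_n) (w : {ffun 'I_n -> T}) (g : T -> R) :
  g (w j) = \prod_l (if l == j then g (w l) else 1).
  by rewrite -big_mkcond big_pred1_eq.
rewrite (bigD1 i) //= [X in _ + X]big1 ?addr0 => [|j ji].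
  under eq_bigr => w _ do rewrite -expr2 (pick i w (fun t => f t ^+ 2)).
  rewrite (weighted (fun l t => if l == i then f t ^+ 2 else 1)) (bigD1 i) //=.
  rewrite eqxx [X in _ * X]big1 ?mulr1 // => l /negPf ->.
  by rewrite -[RHS]q1; apply: eq_bigr => t _; rewrite mulr1.
under eq_bigr => w _ do rewrite (pick i w f) (pick j w f) -big_split /=.
rewrite (weighted (fun l t => (if l == i then f t else 1) *
                              (if l == j then f t else 1))) (bigD1 i) //=.
rewrite [X in X * _](_ : _ = 0) ?mul0r // -[RHS]qf0.
by apply: eq_bigr => t _; rewrite eqxx eq_sym (negPf ji) mulr1.
Qed.

End IndependentSamples.

(** * Sums over a finite outcome set *)

Lemma mx_has_sum_finType (K : numFieldType) d (T : finType) (f : T -> 'M[K]_d) :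
  mx_has_sum f (\sum_t f t).
Proof.
have FF := summability.totally_filter (I := T).
apply: cvg_near_cst; rewrite nearE.
exists [fset t | t in T]%fset => // A /= TA.
rewrite /summability.partial_sum -(big_seq_fsetE _ A predT f) /=.
apply: perm_big; apply: uniq_perm; rewrite ?fset_uniq ?index_enum_uniq // => t.
rewrite mem_index_enum; apply/idP; apply: (fsubsetP TA).
by rewrite in_fset.
Qed.

Lemma esum_finType (R : realType) (T : finType) (a : T -> R) :
  (forall t, 0 <= a t) ->
  esum [set: T] (fun t => (a t)%:E) = (\sum_t a t)%:E.
Proof.
move=> a_ge0; rewrite esum_fset //; last by move=> t _; rewrite lee_fin.
rewrite (fsbigE (enum T)) ?enum_uniq //=.
- rewrite big_enum_cond sumEFin; congr (_%:E).
  by apply: eq_bigl => t; rewrite mem_set.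
- by move=> t _; rewrite mem_enum.
- exact: finite_finset.
Qed.

(** * Randomized signs *)

Section RandomizedSigns.
Variables (R : realType) (d : nat) (b : R).
Hypothesis b_range : 0 <= b <= 1.
Notation signs := {ffun 'I_d -> bool}.
Implicit Types (w : signs) (p : 'I_d -> R).

Definition sgn w k : R := (-1) ^+ w k.

(** Flipping one sign is an involution, under which the monomials containing
    that sign exactly once are odd; this is how their sums vanish. *)
Definition flip k w : signs := [ffun l => w l (+) (l == k)].

Lemma flipK k : involutive (flip k).
Proof. by move=> w; apply/ffunP => l; rewrite !ffunE -addbA addbb addbF. Qed.

Lemma sgn_flip k l w : sgn (flip k w) l = (if l == k then - sgn w l else sgn w l).
Proof.
rewrite /sgn ffunE; case: (l == k); rewrite ?addbF //.
by rewrite addbT; case: (w l); rewrite /= ?opprK.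
Qed.

Lemma sum_odd_eq0 k (f : signs -> R) :
  (forall w, f (flip k w) = - f w) -> \sum_w f w = 0.
Proof.
move=> f_odd; suff : \sum_w f w = - \sum_w f w by lra.
rewrite -sumrN [LHS](reindex_inj (inv_inj (flipK k))).
by apply: eq_bigr => w _; rewrite f_odd.
Qed.

Definition sign_prob w k : R := (2 ^+ d)^-1 * (1 + b * sgn w k).

(** The law of the outcome on a state with populations p. *)
Definition sign_dist p w : R := \sum_k sign_prob w k * p k.

Lemma uniform_weight_gt0 : 0 < (2 ^+ d)^-1 :> R.
Proof. by rewrite invr_gt0 exprn_gt0. Qed.

Lemma sgn_sqr w k : sgn w k ^+ 2 = 1.
Proof. by rewrite sqrr_sign. Qed.

Lemma sign_prob_bounds w k :
  (2 ^+ d)^-1 * (1 - b) <= sign_prob w k <= (2 ^+ d)^-1 * (1 + b).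
Proof.
rewrite !ler_pM2l ?uniform_weight_gt0 // !lerD2l.
have /andP[b_ge0 b_le1] := b_range.
by rewrite /sgn; case: (w k) => /=; rewrite ?expr0 ?expr1; apply/andP; split; lra.
Qed.

Lemma sign_prob_ge0 w k : 0 <= sign_prob w k.
Proof.
have /andP[le _] := sign_prob_bounds w k; apply: le_trans le.
by rewrite mulr_ge0 ?(ltW uniform_weight_gt0) // subr_ge0; case/andP: b_range.
Qed.

Lemma sum_signs1 : \sum_(w : signs) (2 ^+ d)^-1 = 1 :> R.
Proof.
by rewrite sumr_const card_ffun card_bool card_ord -[LHS]mulr_natr natrX mulVf.
Qed.

Lemma sum_sign_prob k : \sum_w sign_prob w k = 1.
Proof.
under eq_bigr do rewrite /sign_prob mulrDr mulr1.
rewrite big_split /= sum_signs1 (@sum_odd_eq0 k) ?addr0 // => w.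
by rewrite sgn_flip eqxx !mulrN.
Qed.

(** The signs are orthonormal under the uniform distribution, so
    correlating w_k with 1 + b w_j detects whether j = k. *)
Lemma sum_sign_prob_sgn j k : \sum_w sign_prob w j * sgn w k = b *+ (j == k).
Proof.
under eq_bigr do rewrite /sign_prob mulrDr mulrDl mulr1.
rewrite big_split (@sum_odd_eq0 k) => [|w] /=; last first.
  by rewrite sgn_flip eqxx mulrN.
rewrite add0r; have [<-|jk] := eqVneq j k.
  under eq_bigr do rewrite -!mulrA -expr2 sgn_sqr mulr1 mulrC.
  by rewrite -mulr_sumr sum_signs1 mulr1.
rewrite (@sum_odd_eq0 k) // => w.
by rewrite !sgn_flip eqxx (negPf jk) mulrN.
Qed.

Section Moments.
Variable p : 'I_d -> R.
Hypothesis sum_p : \sum_k p k = 1.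

Lemma sum_sign_dist : \sum_w sign_dist p w = 1.
Proof.
rewrite exchange_big -[RHS]sum_p; apply: eq_bigr => k _.
by rewrite -mulr_suml sum_sign_prob mul1r.
Qed.

Lemma mean_sgn k : \sum_w sign_dist p w * sgn w k = b * p k.
Proof.
under eq_bigr do rewrite mulr_suml.
rewrite exchange_big /= (bigD1 k) //= [X in _ + X]big1 ?addr0 => [|j jk].
  under eq_bigr do rewrite mulrAC.
  by rewrite -mulr_suml sum_sign_prob_sgn eqxx.
under eq_bigr do rewrite mulrAC.
by rewrite -mulr_suml sum_sign_prob_sgn (negPf jk) mul0r.
Qed.

Lemma centered_sgn k : \sum_w sign_dist p w * (sgn w k - b * p k) = 0.
Proof.
under eq_bigr do rewrite mulrBr.
by rewrite sumrB mean_sgn -mulr_suml sum_sign_dist mul1r subrr.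
Qed.

Lemma variance_sgn k :
  \sum_w sign_dist p w * (sgn w k - b * p k) ^+ 2 = 1 - (b * p k) ^+ 2.
Proof.
set m := b * p k.
have expand w : sign_dist p w * (sgn w k - m) ^+ 2 =
  sign_dist p w - 2 * m * (sign_dist p w * (sgn w k - m))
  - m ^+ 2 * sign_dist p w.
  by have := sgn_sqr w k; set s := sgn w k => s2; rewrite sqrrB s2; ring: s2.
under eq_bigr do rewrite expand.
by rewrite !sumrB -!mulr_sumr centered_sgn sum_sign_dist mulr0 subr0 mulr1.
Qed.

(** The estimator is unbiased, so its squared error in each coordinate is the
    variance of one centered sign, at most 1, over n b^2. *)
Lemma risk_of_mean_sign n : (0 < n)%N -> b != 0 ->
  \sum_(W : {ffun 'I_n -> signs}) (\prod_i sign_dist p (W i))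
      * \sum_k ((\sum_i sgn (W i) k) / (n%:R * b) - p k) ^+ 2
  <= d%:R / (n%:R * b ^+ 2).
Proof.
move=> n_gt0 b_ne0; have n_ne0 : n%:R != 0 :> R by rewrite pnatr_eq0 -lt0n.
under eq_bigr do rewrite mulr_sumr.
rewrite exchange_big /= -[d in leRHS]card_ord -sum1_card natr_sum mulr_suml.
apply: ler_sum => k _.
have errE (W : {ffun 'I_n -> signs}) :
    (\prod_i sign_dist p (W i))
      * ((\sum_i sgn (W i) k) / (n%:R * b) - p k) ^+ 2 =
    (\prod_i sign_dist p (W i)) * (\sum_i (sgn (W i) k - b * p k)) ^+ 2
      * (n%:R * b)^-1 ^+ 2.
  rewrite -mulrA -exprMn; congr (_ * _ ^+ 2).
  by rewrite sumrB sumr_const card_ord; field; rewrite b_ne0 n_ne0.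
under eq_bigr do rewrite errE.
rewrite -mulr_suml (second_moment_iid_sum n sum_sign_dist (centered_sgn k)).
rewrite variance_sgn -[_ *+ n]mulr_natr.
have -> : (1%:R / (n%:R * b ^+ 2) : R) = n%:R * (n%:R * b)^-1 ^+ 2.
  by field; rewrite b_ne0 n_ne0.
rewrite -mulrA; apply: ler_piMl; first by rewrite mulr_ge0 ?sqr_ge0.
by rewrite lerBlDr lerDl sqr_ge0.
Qed.

End Moments.
End RandomizedSigns.

(** * The sign measurement *)

Section SignMeasurement.
Variables (R : realType) (d : nat) (ket : 'I_d -> 'cV[R[i]]_d).
Hypothesis hket : orthonormal_kets ket.
Variable b : R.
Hypothesis b_range : 0 <= b <= 1.

Definition sign_kraus (w : {ffun 'I_d -> bool}) : 'M[R[i]]_d :=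
  kdiag ket (fun k => Num.sqrt (sign_prob b w k)).

Lemma sign_kraus_complete :
  mx_has_sum (fun w => (sign_kraus w)^t* *m sign_kraus w) 1%:M.
Proof.
suff <- : \sum_w (sign_kraus w)^t* *m sign_kraus w = 1%:M.
  exact: mx_has_sum_finType.
under eq_bigr do rewrite kdiag_adj kdiagM //.
rewrite exchange_big /= -(kdiag1 hket); apply: eq_bigr => k _.
rewrite -scaler_suml -rmorph_sum -(sum_sign_prob b k) /=.
congr (_%:C *: _); apply: eq_bigr => w _.
by rewrite -expr2 sqr_sqrtr ?sign_prob_ge0.
Qed.

Definition sign_measurement : measurement R d := Measurement sign_kraus_complete.

Lemma outcome_prob_sign rho w : density rho ->
  outcome_prob rho (sign_kraus w) = sign_dist b (population ket rho) w.
Proof.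
move=> rho_dens; rewrite outcome_prob_kdiag //; apply: eq_bigr => k _.
by rewrite sqr_sqrtr ?sign_prob_ge0.
Qed.

(** Gentleness of a nearly scalar effect: q stands for an eigenvalue, t for
    the outcome probability, both in the band c (1 - b), c (1 + b). The claim
    reduces to (1 + b) / (1 - b) <= (1 + 2 b)^2 and
    (1 - 2 b)^2 <= (1 - b) / (1 + b), both consequences of 2 b^2 <= 1. *)
Lemma sqrt_ratio_close (c q t : R) : 0 < c -> b <= 2^-1 -> 0 < t ->
  c * (1 - b) <= q <= c * (1 + b) -> c * (1 - b) <= t <= c * (1 + b) ->
  `|1 - Num.sqrt q / Num.sqrt t| <= 2 * b.
Proof.
move=> c_gt0 b_le t_gt0 /andP[q_lo q_hi] /andP[t_lo t_hi].
have b_ge0 : 0 <= b by case/andP: b_range.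
have q_ge0 : 0 <= q by apply: le_trans q_lo; rewrite mulr_ge0 ?(ltW c_gt0) //; lra.
set y := _ / _.
have y_ge0 : 0 <= y by rewrite divr_ge0 ?sqrtr_ge0.
have y2 : y ^+ 2 = q / t by rewrite exprMn exprVn !sqr_sqrtr ?(ltW t_gt0).
have poly_ge0 : 0 <= b * (1 - 2 * b ^+ 2) by rewrite mulr_ge0 //; nra.
have hi : y <= 1 + 2 * b.
  rewrite -(@ler_pXn2r _ 2) ?nnegrE ?addr_ge0 ?mulr_ge0 // y2 ler_pdivrMr //.
  apply: le_trans q_hi _.
  apply: (@le_trans _ _ ((1 + 2 * b) ^+ 2 * (c * (1 - b)))).
    by rewrite mulrCA ler_pM2l //; nra.
  by rewrite ler_wpM2l ?sqr_ge0.
have lo : 1 - 2 * b <= y.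
  rewrite -(@ler_pXn2r _ 2) ?nnegrE //; last by lra.
  rewrite y2 ler_pdivlMr //.
  apply: le_trans q_lo.
  apply: (@le_trans _ _ ((1 - 2 * b) ^+ 2 * (c * (1 + b)))).
    by rewrite ler_wpM2l ?sqr_ge0.
  by rewrite mulrCA ler_pM2l //; nra.
by rewrite ler_norml; apply/andP; split; lra.
Qed.

Lemma sign_measurement_gentle : 0 < b <= 2^-1 ->
  gentle (2 * b) sign_measurement.
Proof.
move=> /andP[b_gt0 b_le] rho w rho_dens prob_gt0.
have probE := outcome_prob_sign w rho_dens.
apply: gentle_kdiag => //; first by rewrite mulr_gt0.
move=> k; apply: (@sqrt_ratio_close (2 ^+ d)^-1) => //.
  exact: sign_prob_bounds.
rewrite -/(sign_kraus w) probE /sign_dist.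
(* The outcome probability is an average of the eigenvalues, hence lies in
   the same band. *)
have avg (x : R) : x = \sum_k x * population ket rho k.
  by rewrite -mulr_sumr sum_population // mulr1.
rewrite [X in X <= _ <= _]avg [X in _ <= _ <= X]avg.
apply/andP; split; apply: ler_sum => j _; apply: ler_wpM2r;
  rewrite ?population_ge0 //; by case/andP: (sign_prob_bounds b_range w j).
Qed.

Definition sign_estimator n
    (W : joint_outcome (fun _ : 'I_n => sign_measurement)) : 'cV[R]_d :=
  \col_k ((\sum_i sgn R (W i) k) / (n%:R * b)).

Lemma mean_sq_error_sign n (rho : 'M[R[i]]_d) (p : 'cV[R]_d) :
  (0 < n)%N -> b != 0 -> density rho ->
  (forall k, p k 0 = population ket rho k) ->
  (mean_sq_error (@sign_estimator n) rho p <= (d%:R / (n%:R * b ^+ 2))%:E)%E.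
Proof.
move=> n_gt0 b_ne0 rho_dens pE; rewrite /mean_sq_error.
have sum_p := sum_population hket rho_dens.
have probE (W : {ffun 'I_n -> {ffun 'I_d -> bool}}) :
    outcome_prob (tensor (fun _ : 'I_n => rho)) (tensor (fun i => sign_kraus (W i)))
    = \prod_i sign_dist b (population ket rho) (W i).
  rewrite outcome_prob_tensor; last by case: rho_dens.
  by apply: eq_bigr => i _; rewrite outcome_prob_sign.
have := risk_of_mean_sign sum_p n_gt0 b_ne0.
rewrite -lee_fin; apply: le_trans; rewrite -esum_finType => [|W]; last first.
  rewrite mulr_ge0 ?sumr_ge0 // => [|k _]; last exact: sqr_ge0.
  apply: prodr_ge0 => i _; apply: sumr_ge0 => k _.
  by rewrite mulr_ge0 ?sign_prob_ge0 ?population_ge0.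
rewrite le_eqVlt; apply/orP; left; apply/eqP; apply: eq_esum => W _.
rewrite -probE; congr (_ * _)%:E; apply: eq_bigr => k _.
by rewrite mxE pE.
Qed.

End SignMeasurement.

Theorem theorem6 (R : realType) (d n : nat) (alpha : R)
    (ket : 'I_d -> 'cV[R[i]]_d)
    (hd : (1 <= d)%N) (hn : (1 <= n)%N) (halpha : 0 < alpha < 1)
    (hket : orthonormal_kets ket) :
  exists (M : 'I_n -> measurement R d) (phat : joint_outcome M -> 'cV[R]_d),
    locally_gentle alpha M /\
    (ereal_sup [set e : \bar R | exists (rho : 'M[R[i]]_d) (p : 'cV[R]_d),
                  [/\ pure_state rho, prob_vector_of ket rho p
                    & e = mean_sq_error phat rho p]]
     <= (4 * (d%:R / (n%:R * alpha ^+ 2)))%:E)%E.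
Proof.
have /andP[alpha_gt0 alpha_lt1] := halpha.
(* A sign measurement of bias b is 2 b-gentle. The factor 4 of the bound is
   the square of this 2. *)
pose b : R := alpha / 2.
have b_range : 0 <= b <= 1 by rewrite /b; apply/andP; split; lra.
have b_gentle : 0 < b <= 2^-1 by rewrite /b; apply/andP; split; lra.
have b_ne0 : b != 0 by rewrite /b; lra.
exists (fun _ => sign_measurement hket b_range).
exists (@sign_estimator R d ket hket b b_range n); split.
  move=> i; rewrite (_ : alpha = 2 * b); last by rewrite /b; lra.
  exact: sign_measurement_gentle.
apply: ge_ereal_sup => _ [rho [p [rho_pure p_rho ->]]].
have -> : 4 * (d%:R / (n%:R * alpha ^+ 2)) = d%:R / (n%:R * b ^+ 2).
  have n_ne0 : n%:R != 0 :> R by rewrite pnatr_eq0 -lt0n.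
  by rewrite /b; field; rewrite n_ne0 gt_eqF //; lra.
apply: mean_sq_error_sign => //; first exact: density_pure.
by move=> k; apply: population_prob_vector.
Qed.
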